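(* Let $G=(V,E,w)$ be a finite connected graph with $|V|=n\ge2$ and weights $w:E\to\mathbb{R}_{>0}$. Then $$\operatorname{OPT}_{\mathrm{free}}(G,w)=\min_{T\in\mathcal T_{\mathrm{conn}}^{\mathrm{bin}}(G)}\ \sum_{xy\in E}w_{xy}\operatorname{diam}_{d_G}\bigl(C_T(x,y)\bigr).$$ In particular, the free optimum $\operatorname{OPT}_{\mathrm{free}}(G,w)$ is attained by the diameter labeling $u_T^{\mathrm{diam}}$ of some connected binary hierarchy $T\in\mathcal T_{\mathrm{conn}}^{\mathrm{bin}}(G)$.
   Context: $d_G$ is the shortest-path metric of the support graph $(V,E)$ with every edge of length $1$; the weights are not edge lengths. An ultrametric on $V$ is a metric $u$ on $V$ with $u(x,y)\le\max\{u(x,z),u(z,y)\}$ for all $x,y,z$; it dominates $d_G$ if $u(x,y)\ge d_G(x,y)$ for all $x,y\in V$. $\operatorname{OPT}_{\mathrm{free}}(G,w)$ is the minimum (a priori, infimum) of $\sum_{xy\in E}w_{xy}u(x,y)$ over all ultrametrics $u$ on $V$ dominating $d_G$. A rooted binary hierarchy $T$ on $V$ is a rooted tree whose leaves are the vertices of $V$ and whose internal nodes have exactly two children; each node is identified with the set of leaves below it (a cluster), and $C_T(x,y)$ is the cluster of the lowest common ancestor of $x,y$. $\mathcal T_{\mathrm{conn}}^{\mathrm{bin}}(G)$ is the set of rooted binary hierarchies on $V$ all of whose clusters induce connected subgraphs of $G$. $\operatorname{diam}_{d_G}(S)=\max_{a,b\in S}d_G(a,b)$. The diameter labeling is $u_T^{\mathrm{diam}}(x,x)=0$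 and $u_T^{\mathrm{diam}}(x,y)=\operatorname{diam}_{d_G}(C_T(x,y))$ for $x\neq y$. *)

(* Defs.v *)
(* MathComp + MathComp-Analysis. *)
From mathcomp Require Import all_boot all_order all_algebra.
From mathcomp Require Import boolp classical_sets reals.

Set Implicit Arguments.
Unset Strict Implicit.
Unset Printing Implicit Defensive.

Import Order.TTheory GRing.Theory Num.Theory.
Local Open Scope ring_scope.

Section Graph.
Variables (V : finType) (e : rel V).

Definition connected_graph : Prop := forall x y, connect e x y.

Definition induced_connected (S : {set V}) : Prop :=
  {in S &, forall x y, connect [rel a b | [&& e a b, a \in S & b \in S]] x y}.

Definition walk (n : nat) (x y : V) : bool :=
  [exists p : n.-tuple V, path e x p && (last x p == y)].

(* Least length of a walk.  Distances in a connected graph are < #|V|, so    *)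
(* searching 0, ..., #|V|-1 is enough; the junk value #|V| is returned when   *)
(* y cannot be reached from x.                                                *)
Definition gdist (x y : V) : nat := find (fun n => walk n x y) (iota 0 #|V|).

Definition diam (S : {set V}) : nat :=
  \max_(a in S) \max_(b in S) gdist a b.

End Graph.

Section Hierarchy.
Variable V : finType.

(* The order of the two children carries no meaning. *)
Inductive btree : Type := Leaf of V | Node of btree & btree.

Fixpoint leaves (T : btree) : seq V :=
  match T with Leaf x => [:: x] | Node l r => leaves l ++ leaves r end.

Definition cluster (T : btree) : {set V} := [set x in leaves T]%SET.

Fixpoint clusters (T : btree) : seq {set V} :=
  cluster T :: match T with
               | Leaf _ => [::]
               | Node l r => clusters l ++ clusters r
               end.

Definition hierarchy (T : btree) : Prop := perm_eq (leaves T) (enum V).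

(* The node, as the subtree it roots; meaningful for leaves x, y of T. *)
Fixpoint lca (T : btree) (x y : V) : btree :=
  match T with
  | Leaf _ => T
  | Node l r =>
      if (x \in leaves l) && (y \in leaves l) then lca l x y
      else if (x \in leaves r) && (y \in leaves r) then lca r x y
      else T
  end.

Definition lca_cluster (T : btree) (x y : V) : {set V} := cluster (lca T x y).

Definition connected_hierarchy (e : rel V) (T : btree) : Prop :=
  hierarchy T /\ (forall S, S \in clusters T -> induced_connected e S).

End Hierarchy.

Section Ultrametric.
Variables (R : realType) (V : finType).
Implicit Types (e : rel V) (w u : V -> V -> R) (T : btree V).

Definition metric u : Prop :=
  [/\ forall x y, 0 <= u x y,
      forall x y, u x y = 0 <-> x = y,
      forall x y, u x y = u y x
    & forall x y z, u x y <= u x z + u z y].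

Definition ultrametric u : Prop :=
  metric u /\ forall x y z, u x y <= Num.max (u x z) (u z y).

Definition dominates e u : Prop := forall x y, (gdist e x y)%:R <= u x y.

(* Comparing ranks selects exactly one orientation (x, y) of every edge; for  *)
(* symmetric w and u the choice of orientation is irrelevant.                 *)
Definition edge_sum e w u : R :=
  \sum_(p : V * V | e p.1 p.2 && (enum_rank p.1 < enum_rank p.2)%N)
     w p.1 p.2 * u p.1 p.2.

Definition OPT_free e w : R :=
  inf [set edge_sum e w u | u in [set u | ultrametric u /\ dominates e u]]%classic.

Definition hierarchy_cost e w T : R :=
  edge_sum e w (fun x y => (diam e (lca_cluster T x y))%:R).

Definition diam_labeling e T : V -> V -> R :=
  fun x y => if x == y then 0 else (diam e (lca_cluster T x y))%:R.

Definition is_min (A : set R) (m : R) : Prop := A m /\ lbound A m.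

End Ultrametric.

Arguments diam_labeling R {V} e T _ _.

(* Main.v *)
(* The diameter labeling of any connected hierarchy is an ultrametric dominating
   the graph distance. Conversely, given a dominating ultrametric u, run Kruskal's
   algorithm with edge lengths u: repeatedly merge the two current clusters joined
   by a u-shortest crossing edge. Merging along an edge of length s produces a
   connected cluster of u-diameter at most s, hence of d_G-diameter at most s,
   while every edge it newly encloses was crossing, so has length at least s.
   Thus the resulting hierarchy costs no more than u. The minimum over hierarchies
   exists because diameter labels take finitely many values. *)
Require Import Defs.
From mathcomp Require Import all_boot all_order all_algebra.
From mathcomp Require Import boolp classical_sets reals.
Import Order.TTheory GRing.Theory Num.Theory.
Local Open Scope ring_scope.

(** * Graph distances, diameters and unions of connected sets *)

Section GraphDistance.
Variables (V : finType) (e : rel V).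

Lemma gdist_le_card (x y : V) : (gdist e x y <= #|V|)%N.
Proof. by rewrite /gdist -[leqRHS](size_iota 0) find_size. Qed.

Lemma walk0 (x y : V) : walk e 0 x y = (x == y).
Proof.
apply/existsP/idP => [[p]|/eqP ->]; first by rewrite tuple0.
by exists [tuple] => /=.
Qed.

Lemma gdist_eq0 (x y : V) : (gdist e x y == 0%N) = (x == y).
Proof.
(* Since [x] inhabits [V], the search range is nonempty and length 0 is tested first. *)
have : (0 < #|V|)%N by apply/card_gt0P; exists x.
by rewrite /gdist; case: #|V| => //= n _; rewrite walk0; case: (x == y).
Qed.

Lemma gdist_le_diam (S : {set V}) (x y : V) :
  x \in S -> y \in S -> (gdist e x y <= diam e S)%N.
Proof.
move=> xS yS; apply: leq_trans (leq_bigmax_cond _ xS).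
exact: (leq_bigmax_cond (F := gdist e x)).
Qed.

(** A maximum of naturals is 0 or one of its terms. Leaving [P] general lets it also express bounds
    after the cast to [R]. *)
Lemma diam_ind (P : nat -> Prop) (S : {set V}) :
  P 0%N -> {in S &, forall a b, P (gdist e a b)} -> P (diam e S).
Proof.
move=> P0 Pd.
have Pmax m n : P m -> P n -> P (maxn m n) by rewrite /maxn; case: ifP.
apply: (big_ind P) => // a aS; apply: (big_ind P) => // b bS; exact: Pd.
Qed.

Lemma diam_le_card (S : {set V}) : (diam e S <= #|V|)%N.
Proof. by apply: (diam_ind (fun n => n <= #|V|)%N) => // a b _ _; exact: gdist_le_card. Qed.

Lemma diamS (A B : {set V}) : A \subset B -> (diam e A <= diam e B)%N.
Proof.
move=> /fintype.subsetP AB; apply: (diam_ind (fun n => n <= diam e B)%N) => // a b aA bA.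
by apply: gdist_le_diam; exact: AB.
Qed.

(** The edge [x y] bridges the two sets: walk to its end on one side, cross it, and walk on. *)
Lemma induced_connectedU (A B : {set V}) (x y : V) :
  symmetric e -> e x y -> x \in A -> y \in B ->
  induced_connected e A -> induced_connected e B ->
  induced_connected e (A :|: B).
Proof.
move=> e_sym exy xA yB cA cB.
set eU := [rel a b | [&& e a b, a \in A :|: B & b \in A :|: B]].
have subU (C : {set V}) : C \subset A :|: B -> induced_connected e C ->
    {in C &, forall a b, connect eU a b}.
  move=> /fintype.subsetP CU cC a b aC bC; apply: connect_sub (cC _ _ aC bC).
  by move=> {aC bC} {}a {}b /= /and3P[eab aC bC]; apply: connect1; rewrite /= eab !CU.
have kA := subU _ (finset.subsetUl A B) cA; have kB := subU _ (finset.subsetUr A B) cB.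
have kxy : connect eU x y by apply: connect1; rewrite /= exy !inE xA yB orbT.
have kyx : connect eU y x by apply: connect1; rewrite /= e_sym exy !inE xA yB orbT.
move=> a b; rewrite !inE => /orP[aA|aB] /orP[bA|bB].
- exact: kA.
- apply: connect_trans (kA _ _ aA xA) _; apply: connect_trans kxy _; exact: kB.
- apply: connect_trans (kB _ _ aB yB) _; apply: connect_trans kyx _; exact: kA.
- exact: kB.
Qed.

End GraphDistance.

(** * Clusters of lowest common ancestors *)

Section LowestCommonAncestor.
Variable V : finType.
Implicit Types (T l r : btree V) (x y z : V).

Lemma mem_cluster T x : (x \in cluster T) = (x \in leaves T).
Proof. by rewrite inE. Qed.

Lemma cluster_Node l r : cluster (Node l r) = cluster l :|: cluster r.
Proof. by apply/setP => x; rewrite !inE mem_cat. Qed.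

Lemma lca_clusterC T x y : lca_cluster T x y = lca_cluster T y x.
Proof.
rewrite /lca_cluster; congr cluster.
by elim: T => //= l -> r ->; rewrite [_ && _]andbC [(x \in leaves r) && _]andbC.
Qed.

Lemma lca_cluster_sub T x y : lca_cluster T x y \subset cluster T.
Proof.
rewrite /lca_cluster; elim: T => //= l IHl r IHr; rewrite cluster_Node.
case: ifP => _; first exact: fintype.subset_trans IHl (finset.subsetUl _ _).
by case: ifP => _ //; [exact: fintype.subset_trans IHr (finset.subsetUr _ _)|rewrite cluster_Node].
Qed.

Lemma mem_lca_cluster T x y : x \in leaves T -> y \in leaves T ->
  x \in lca_cluster T x y.
Proof.
rewrite /lca_cluster; elim: T => [v|l IHl r IHr] /=; first by rewrite mem_cluster.
move=> xT yT; case: ifP => [/andP[? ?]|_]; first exact: IHl.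
by case: ifP => [/andP[? ?]|_]; [exact: IHr|rewrite mem_cluster].
Qed.

(** If one child holds all three leaves, recurse into it. Otherwise [z] is separated from [x] or
    from [y] at the root, so one of the clusters on the right is the whole tree. *)
Lemma lca_cluster_ultra T x y z : uniq (leaves T) ->
  x \in leaves T -> y \in leaves T -> z \in leaves T ->
  (lca_cluster T x y \subset lca_cluster T x z) ||
  (lca_cluster T x y \subset lca_cluster T z y).
Proof.
elim: T => [v|l IHl r IHr] /=; first by rewrite /lca_cluster /= subxx.
rewrite cat_uniq => /and3P[ul /hasPn dis ur].
have memr v : v \in leaves (Node l r) -> (v \in leaves r) = (v \notin leaves l).
  rewrite /= mem_cat; have [vl _|//] := boolP (v \in leaves l).
  by apply/negP => /dis; rewrite vl.
move=> xT yT zT; have := lca_cluster_sub (Node l r) x y.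
move: IHl IHr; rewrite /lca_cluster /= !memr //.
case: (x \in _) (y \in _) (z \in _) => [] [] [] /= IHl IHr sxy;
  by first [exact: IHl | exact: IHr | rewrite sxy ?orbT].
Qed.

End LowestCommonAncestor.

(** * The diameter labeling as a dominating ultrametric *)

Section DiameterLabeling.
Variables (R : realType) (V : finType) (e : rel V) (T : btree V).
Hypothesis hT : hierarchy T.

Lemma hierarchy_leaves x : x \in leaves T.
Proof. by rewrite (perm_mem hT) mem_enum. Qed.

Lemma hierarchy_uniq : uniq (leaves T).
Proof. by rewrite (perm_uniq hT) enum_uniq. Qed.

Lemma dominates_diam_labeling : dominates e (diam_labeling R e T).
Proof.
move=> x y; rewrite /diam_labeling; case: eqVneq => [->|_].
  by rewrite lern0 gdist_eq0.
rewrite ler_nat; apply: gdist_le_diam; last rewrite lca_clusterC;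
  by apply: mem_lca_cluster; exact: hierarchy_leaves.
Qed.

Lemma ultrametric_diam_labeling : ultrametric (diam_labeling R e T).
Proof.
set u := diam_labeling R e T.
have u_ge0 x y : 0 <= u x y by rewrite /u /diam_labeling; case: ifP.
have u_ultra x y z : u x y <= Num.max (u x z) (u z y).
  have [->|nxy] := eqVneq x y; first by rewrite {1}/u /diam_labeling eqxx le_max u_ge0.
  have [->|nxz] := eqVneq x z; first by rewrite le_max lexx orbT.
  have [->|nzy] := eqVneq z y; first by rewrite le_max lexx.
  rewrite /u /diam_labeling (negbTE nxy) (negbTE nxz) (negbTE nzy) le_max !ler_nat.
  have /orP[s|s] := lca_cluster_ultra _ _ x y z hierarchy_uniq
    (hierarchy_leaves x) (hierarchy_leaves y) (hierarchy_leaves z);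
    by rewrite (diamS _ _ _ _ s) ?orbT.
split=> //; split=> // [x y|x y|x y z].
- split=> [uxy0|->]; last by rewrite /u /diam_labeling eqxx.
  (* Domination separates points: a zero label forces distance zero. *)
  have := dominates_diam_labeling x y; rewrite -/u uxy0.
  by rewrite lern0 gdist_eq0 => /eqP.
- by rewrite /u /diam_labeling eq_sym lca_clusterC.
- apply: le_trans (u_ultra x y z) _.
  by rewrite ge_max lerDl lerDr !u_ge0.
Qed.

(** The two labelings can differ only on the diagonal, which carries no edge. *)
Lemma edge_sum_diam_labeling (w : V -> V -> R) : irreflexive e ->
  edge_sum e w (diam_labeling R e T) = hierarchy_cost e w T.
Proof.
move=> e_irr; apply: eq_bigr => -[x y] /= /andP[exy _]; rewrite /diam_labeling.
by case: eqVneq exy => // ->; rewrite e_irr.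
Qed.

End DiameterLabeling.

(** * Kruskal's algorithm with a dominating ultrametric as edge length *)

Section Kruskal.
Variables (R : realType) (V : finType) (e : rel V) (u : V -> V -> R).
Hypotheses (e_sym : symmetric e) (e_conn : connected_graph e).
Hypotheses (u_ultra : ultrametric u) (u_dom : dominates e u).

Lemma diam_le_ultra (S : {set V}) (s : R) : 0 <= s ->
  {in S &, forall a b, u a b <= s} -> (diam e S)%:R <= s.
Proof.
move=> s0 uS; apply: (diam_ind _ _ (fun n => n%:R <= s)) => // a b aS bS.
exact: le_trans (u_dom a b) (uS _ _ aS bS).
Qed.

(* [F x] is the tree of the forest containing [x], and [t] is the length of the
   last merging edge. *)
Record kruskal_forest (F : V -> btree V) (t : R) : Prop := KruskalForest {
  forest_mem : forall x, x \in leaves (F x);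
  forest_eq : forall x y, y \in leaves (F x) -> F y = F x;
  forest_uniq : forall x, uniq (leaves (F x));
  forest_conn : forall x S, S \in clusters (F x) -> induced_connected e S;
  forest_inside : forall x y, y \in leaves (F x) -> u x y <= t;
  forest_across : forall x y, e x y -> y \notin leaves (F x) -> t <= u x y;
  forest_diam : forall z a b, a \in leaves (F z) -> b \in leaves (F z) ->
    e a b -> (diam e (lca_cluster (F z) a b))%:R <= u a b }.

Lemma kruskal_forest0 : kruskal_forest (@Leaf V) 0.
Proof.
have [[u_ge0 u_eq0 _ _] _] := u_ultra.
split=> [x|x y|x|x S|x y|x y _ _|z a b] //=.
- by rewrite inE.
- by rewrite inE => /eqP ->.
- rewrite inE => /eqP -> a b; rewrite !inE => /eqP -> /eqP ->; exact: connect0.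
- by rewrite inE => /eqP ->; rewrite (proj2 (u_eq0 x x)).
(* An edge inside a singleton would be a loop; its cluster has diameter 0. *)
- rewrite !inE => /eqP -> /eqP -> _; apply: diam_le_ultra => // c d.
  by rewrite !inE => /eqP -> /eqP ->; rewrite (proj2 (u_eq0 z z)).
Qed.

Definition merge (F : V -> btree V) (x y : V) (z : V) : btree V :=
  if z \in leaves (Node (F x) (F y)) then Node (F x) (F y) else F z.

Lemma kruskal_forest_merge (F : V -> btree V) (t : R) (x y : V) :
  kruskal_forest F t -> e x y -> y \notin leaves (F x) ->
  (forall a b, e a b -> b \notin leaves (F a) -> u x y <= u a b) ->
  kruskal_forest (merge F x y) (u x y).
Proof.
have [[u_ge0 _ u_sym _] ultra] := u_ultra.
move=> [Fm Feq Fu Fc Fi Fa Fd] exy nyx min_xy.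
(* Merging lengths never decrease, because [x y] crosses between trees of [F]. *)
have tu : t <= u x y by exact: Fa.
have mF z v : v \in leaves (F z) -> z \in leaves (F v).
  by move=> /Feq ->; exact: Fm.
have dis z : z \in leaves (F x) -> z \in leaves (F y) = false.
  by move=> zx; apply/negP => zy; case/negP: nyx; rewrite -(Feq x z zx) (Feq y z zy).
have same z a b : a \in leaves (F z) -> b \in leaves (F z) -> b \in leaves (F a).
  by move=> /Feq ->.
have within z a b : a \in leaves (F z) -> b \in leaves (F z) -> u a b <= u x y.
  by move=> az bz; apply: le_trans tu; apply: Fi; exact: same bz.
(* For [a] and [b] in different trees, the ultrametric inequality is applied twice along [a], [x],
   [y], [b]. *)
have bound : {in leaves (Node (F x) (F y)) &, forall a b, u a b <= u x y}.
  have cross a b : a \in leaves (F x) -> b \in leaves (F y) -> u a b <= u x y.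
    move=> ax yb; apply: le_trans (ultra a b x) _; rewrite ge_max.
    rewrite (within x) //=; apply: le_trans (ultra x b y) _.
    by rewrite ge_max lexx (within y).
  move=> a b; rewrite /= !mem_cat => /orP[] aT /orP[] bT.
  - exact: within bT.
  - exact: cross.
  - by rewrite u_sym; exact: cross.
  - exact: within bT.
(* Trees of the forest are equal or disjoint, so a tree not merged misses the new node entirely. *)
have outside z v : z \notin leaves (Node (F x) (F y)) -> v \in leaves (F z) ->
    v \notin leaves (Node (F x) (F y)).
  move=> nz vz; apply: contra nz; rewrite /= !mem_cat => /orP[] vT;
  by rewrite -(Feq _ _ vT) (mF _ _ vz) ?orbT.
split=> [z|z v|z|z S|z v|a b eab|z a b]; rewrite /merge; case: ifPn => //.
- by move=> zN vN; rewrite vN.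
- by move=> zN vz; rewrite (negbTE (outside _ _ zN vz)); exact: Feq.
- move=> _ /=; rewrite cat_uniq !Fu andbT /=; apply/hasPn => v vy.
  by apply/negP => /dis; rewrite vy.
- move=> _ /=; rewrite inE mem_cat => /or3P[/eqP ->|/Fc//|/Fc//].
  have cF v : induced_connected e (cluster (F v)).
    by apply: (Fc v); case: (F v) => *; rewrite /= inE eqxx.
  by rewrite cluster_Node; apply: (induced_connectedU _ _ _ _ x y); rewrite ?mem_cluster.
- by move=> _; exact: Fc.
- by move=> zN vN; exact: bound.
- by move=> _ vz; apply: le_trans tu; exact: Fi.
- move=> aN bN; apply: min_xy => //; apply: contra bN => ba.
  by apply: contraLR aN => bN; exact: outside bN (mF _ _ ba).
- by move=> _ /min_xy; exact.
- move=> zN aN bN eab.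
  rewrite /lca_cluster /=; case: ifP => [/andP[? ?]|nx]; first exact: Fd.
  case: ifP => [/andP[? ?]|ny]; first exact: Fd.
  (* An edge split by the new root had its ends in different old trees, so it is at least as long as
     [x y]. *)
  have crossing : b \notin leaves (F a).
    move: aN; rewrite /= mem_cat => /orP[] aT; rewrite (Feq _ _ aT).
      by rewrite aT /= in nx; rewrite nx.
    by rewrite aT /= in ny; rewrite ny.
  apply: le_trans (min_xy _ _ eab crossing); apply: diam_le_ultra => // c d.
  by rewrite !mem_cluster; exact: bound.
- by move=> _; exact: Fd.
Qed.

(** Induction on the number of ordered pairs, adjacent or not, lying in different trees: a merge
    along a shortest crossing edge [x y] creates no such pair and removes [(x, y)]. *)
Lemma kruskal_forest_complete (F : V -> btree V) (t : R) : kruskal_forest F t ->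
  exists F' t', kruskal_forest F' t' /\ forall x y, e x y -> y \in leaves (F' x).
Proof.
pose crossing F := [set p : V * V | p.2 \notin leaves (F p.1)].
have [n] := ubnP #|crossing F|; elim: n F t => // n IHn F t ltn kF.
pose P (p : V * V) := e p.1 p.2 && (p.2 \notin leaves (F p.1)).
have [p0 Pp0|noP] := pickP P; last first.
  exists F, t; split=> // x y exy.
  by have := noP (x, y); rewrite /P /= exy /= => /negbFE.
have [[x y] /andP[/= exy nyx] minxy] := arg_minP (fun p => u p.1 p.2) Pp0.
apply: IHn (kruskal_forest_merge _ _ _ _ kF exy nyx _); last first.
  by move=> a b eab nab; apply: (minxy (a, b)); rewrite /P /= eab.
apply: leq_trans (proper_card _) ltn; apply/fintype.properP; split.
  apply/fintype.subsetP => -[a b]; rewrite !inE /=; apply: contra => bF; rewrite /merge.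
  case: ifP => //=; rewrite !mem_cat => /orP[] aT;
    by rewrite -(forest_eq _ _ kF _ _ aT) bF ?orbT.
exists (x, y); rewrite !inE //= /merge /=.
by rewrite !mem_cat !(forest_mem _ _ kF) /= mem_cat (forest_mem _ _ kF) orbT.
Qed.

Lemma ultrametric_hierarchy (x0 : V) : exists2 T : btree V,
  connected_hierarchy e T &
  forall x y, e x y -> (diam e (lca_cluster T x y))%:R <= u x y.
Proof.
have [F [t [kF Fe]]] := kruskal_forest_complete _ _ kruskal_forest0.
have allF x : x \in leaves (F x0).
  (* No edge leaves the final tree of [x0], so connectedness of the graph makes it spanning. *)
  have cl : closed e (mem (leaves (F x0))).
    apply: intro_closed => [|a b eab aF]; first exact: sym_connect_sym.
    by rewrite -(forest_eq _ _ kF _ _ aF); exact: Fe.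
  by rewrite -(closed_connect cl (e_conn x0 x)); exact: forest_mem kF _.
exists (F x0) => [|x y exy]; last exact: forest_diam kF _ _ _ _ _ exy.
split=> [|S]; last exact: forest_conn kF _ _.
apply: uniq_perm; rewrite ?enum_uniq ?(forest_uniq _ _ kF) // => x.
by rewrite mem_enum allF.
Qed.

End Kruskal.

(** * Existence of a minimal hierarchy and equality of the optima *)

Lemma ultrametric_const (R : realType) (V : finType) (c : R) : 0 < c ->
  ultrametric (fun x y : V => if x == y then 0 else c).
Proof.
move=> c0; have uge0 (x y : V) : 0 <= (if x == y then 0 else c) by case: ifP => // _; exact: ltW.
have ultra (x y z : V) : (if x == y then 0 else c) <=
    Num.max (if x == z then 0 else c) (if z == y then 0 else c).
  rewrite le_max; have [->|xz] := eqVneq x z; first by rewrite lexx orbT.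
  by case: (x == y); rewrite ?lexx // ltW.
split=> //; split=> // [x y|x y|x y z].
- have [->|/eqP nxy] := eqVneq x y; first by split.
  by split=> // c_eq0; rewrite c_eq0 ltxx in c0.
- by rewrite eq_sym.
- by apply: le_trans (ultra x y z) _; rewrite ge_max lerDl lerDr !uge0.
Qed.


(** The type of trees is infinite, but the cost depends only on the diameter labels, which form a
    function between finite types; the minimum is taken over the labels that are realized. *)
Lemma min_hierarchy_cost (R : realType) (V : finType) (e : rel V)
    (w : V -> V -> R) :
  (exists T : btree V, connected_hierarchy e T) ->
  exists2 T : btree V, connected_hierarchy e T &
    forall T', connected_hierarchy e T' -> hierarchy_cost e w T <= hierarchy_cost e w T'.
Proof.
pose label (T : btree V) : {ffun V * V -> 'I_#|V|.+1} :=
  [ffun p => inord (diam e (lca_cluster T p.1 p.2))].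
pose cost (f : {ffun V * V -> 'I_#|V|.+1}) : R :=
  edge_sum e w (fun x y => (f (x, y))%:R).
have costE T : hierarchy_cost e w T = cost (label T).
  by apply: eq_bigr => -[x y] _; rewrite ffunE inordK // ltnS diam_le_card.
pose P f := `[< exists2 T, connected_hierarchy e T & f = label T >].
case=> T0 hT0; have PT0 : P (label T0) by apply/asboolP; exists T0.
have [f /asboolP[T hT fT] minf] := arg_minP cost PT0.
exists T => // T' hT'; rewrite !costE -fT; apply: minf; apply/asboolP.
by exists T'.
Qed.

Theorem corollary2 (R : realType) (V : finType) (e : rel V) (w : V -> V -> R)
    (e_sym : symmetric e) (e_irr : irreflexive e) (e_conn : connected_graph e)
    (V_ge2 : (2 <= #|V|)%N)
    (w_sym : forall x y, e x y -> w x y = w y x)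
    (w_gt0 : forall x y, e x y -> 0 < w x y) :
  is_min [set hierarchy_cost e w T | T in [set T | connected_hierarchy e T]]%classic
         (OPT_free e w)
  /\ (exists T : btree V,
        [/\ connected_hierarchy e T,
            ultrametric (diam_labeling R e T),
            dominates e (diam_labeling R e T)
          & edge_sum e w (diam_labeling R e T) = OPT_free e w]).
Proof.
have [x0 _] : exists x0, x0 \in V by apply/card_gt0P; exact: ltnW.
have V_gt0 : 0 < #|V|%:R :> R by rewrite ltr0n ltnW.
(* Some connected hierarchy exists: apply the Kruskal construction to the constant ultrametric
   [#|V|], which dominates because every [gdist] is at most [#|V|]. *)
have [|T hT minT] := min_hierarchy_cost R V e w.
  have [|T hT _] := ultrametric_hierarchy R V e _ e_sym e_conn
    (ultrametric_const R V _ V_gt0) _ x0; last by exists T.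
  move=> x y; case: eqVneq => [->|_]; last by rewrite ler_nat gdist_le_card.
  by rewrite lern0 gdist_eq0.
have [hierT _] := hT.
have ultT := ultrametric_diam_labeling R V e T hierT.
have domT := dominates_diam_labeling R V e T hierT.
have costT := edge_sum_diam_labeling R V e T w e_irr.
have OPT_T : OPT_free e w = hierarchy_cost e w T.
  (* Each competitor [u] yields a hierarchy [T'] that is no costlier edge by edge, and [T] costs at
     most as much as [T']. *)
  have lb : lbound [set edge_sum e w u | u in
      [set u | ultrametric u /\ dominates e u]]%classic (hierarchy_cost e w T).
    move=> _ [u [ult_u dom_u] <-].
    have [T' hT' leT'] := ultrametric_hierarchy R V e u e_sym e_conn ult_u dom_u x0.
    apply: le_trans (minT _ hT') _; apply: ler_sum => -[x y] /= /andP[exy _].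
    by rewrite ler_pM2l ?w_gt0 // leT'.
  (* The labeling of [T] is itself a competitor, so it bounds the infimum from above and shows that
     the set is nonempty. *)
  apply/le_anti/andP; split.
    apply: ge_inf; first by exists (hierarchy_cost e w T).
    by exists (diam_labeling R e T).
  apply: lb_le_inf => //.
  by exists (hierarchy_cost e w T), (diam_labeling R e T).
split; last by exists T; split => //; rewrite OPT_T.
rewrite OPT_T; split; first by exists T.
by move=> _ [T' hT' <-]; exact: minT.
Qed.
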